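(* Every $\beta$-$\sigma$-unfavorable topological space $X$ is a strongly Baire space.
   Context: For a subset $C$ of a topological space, ${\rm int}(C)$ denotes its interior and $\overline{C}$ its closure. A transfinite net $(A_\xi:\xi<\alpha)$ of sets indexed by the ordinals below $\alpha$ is increasing if $A_\xi\subseteq A_\eta$ whenever $\xi\le\eta<\alpha$. Let $\mathcal P$ be a system of subsets of a topological space $X$. The $G_{\mathcal P}$-game on $X$ is played by players $\alpha$ and $\beta$. The first move of $\beta$ is a nonempty open set $U_0\subseteq X$; then $\alpha$ chooses a nonempty open set $V_1\subseteq U_0$ and a set $P_1\in\mathcal P$; then $\beta$ chooses a nonempty open set $U_1\subseteq V_1$, $\alpha$ chooses a nonempty open set $V_2\subseteq U_1$ and a set $P_2\in\mathcal P$, and so on. Player $\alpha$ wins if $\big(\bigcap_{n=1}^\infty V_n\big)\cap\overline{\bigcup_{n=1}^\infty P_n}\neq\emptyset$; otherwise $\beta$ wins. When $\mathcal P$ is the system of all finite subsets of $X$ (or of all one-point subsets of $X$; either choice is allowed), the game is called the $\sigma$-game. The space $X$ is $\beta$-$\sigma$-unfavorable if player $\beta$ has no winning strategy in the $\sigma$-game on $X$. Let $\alpha$ be an ordinal. A net $(B_\xi:\xi<\alpha)$ of sets occupies a net $(A_\xi:\xi<\alpha)$ of sets if (i) $A_\xi\subseteq B_\xi$ for every $\xi<\alpha$; and (ii) $A_\beta\subseteq\bigcup_{\xi<\beta}B_\xi$ for every (nonzero) limit ordinal $\beta<\alpha$. A topological space $X$ is strongly Baire if for every ordinal $\alpha$,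 every increasing net $(A_\xi:\xi<\alpha)$ of closed subsets of $X$ and every increasing net $(B_\xi:\xi<\alpha)$ of closed subsets of $X$ which occupies $(A_\xi:\xi<\alpha)$, one has ${\rm int}\big(\bigcup_{\xi<\alpha}A_\xi\big)\subseteq\overline{\bigcup_{\xi<\alpha}{\rm int}(B_\xi)}$. *)

(* Defs.v *)
From HB Require Import structures.
From mathcomp Require Import all_boot all_order.
From mathcomp Require Import boolp classical_sets cardinality wochoice.
From mathcomp Require Import topology.

Set Implicit Arguments.
Unset Strict Implicit.
Unset Printing Implicit Defensive.

Local Open Scope classical_set_scope.

Section Game.
Variables (X : topologicalType) (PP : set (set X)).

(* A move of alpha: the pair (V_n, P_n). *)
Definition alpha_move : Type := set X * set X.

(* The legal answers of alpha to the open set U played by beta. *)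
Definition legal_alpha_move (U : set X) (m : alpha_move) : Prop :=
  [/\ open m.1, m.1 !=set0, m.1 `<=` U & PP m.2].

(* s h is the set played by beta after alpha has made the moves h, the oldest
   move being at the head of h; s [::] is the opening move U_0. *)
Definition beta_strategy : Type := seq alpha_move -> set X.

(* h is a sequence of moves that alpha can make when beta follows s. *)
Definition legal_history (s : beta_strategy) (h : seq alpha_move) : Prop :=
  forall i, (i < size h)%N ->
    legal_alpha_move (s (take i h)) (nth (setT, set0) h i).

(* beta's sets are nonempty, open, and contained in alpha's last open set; the
   default value setT of last says that U_0 is only required to lie in X. *)
Definition legal_beta_strategy (s : beta_strategy) : Prop :=
  forall h, legal_history s h ->
    [/\ open (s h), s h !=set0 & s h `<=` (last (setT, set0) h).1].

(* m is the sequence of moves of alpha in an infinite play in which beta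
   follows s: m n is the pair (V_{n+1}, P_{n+1}). *)
Definition legal_play (s : beta_strategy) (m : nat -> alpha_move) : Prop :=
  forall n, legal_alpha_move (s (mkseq m n)) (m n).

Definition alpha_wins (m : nat -> alpha_move) : Prop :=
  (\bigcap_n (m n).1) `&` closure (\bigcup_n (m n).2) !=set0.

Definition winning_beta_strategy (s : beta_strategy) : Prop :=
  legal_beta_strategy s /\ forall m, legal_play s m -> ~ alpha_wins m.

Definition beta_unfavorable : Prop :=
  ~ exists s : beta_strategy, winning_beta_strategy s.

End Game.

Definition finite_subsets (X : Type) : set (set X) := [set P | finite_set P].

Definition one_point_subsets (X : Type) : set (set X) :=
  [set P | exists x, P = [set x]].

(* The two systems that define the sigma-game. *)
Definition sigma_system (X : Type) (PP : set (set X)) : Prop :=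
  PP = @finite_subsets X \/ PP = @one_point_subsets X.

(* An ordinal alpha is represented by a well-ordered type I, whose elements
   are the ordinals below alpha. *)
Section Nets.
Context {d : Order.disp_t} {I : orderType d}.

Definition increasing_net (T : Type) (A : I -> set T) : Prop :=
  forall i j : I, (i <= j)%O -> A i `<=` A j.

Definition limit_index (b : I) : Prop :=
  (exists i : I, (i < b)%O) /\
  forall i : I, (i < b)%O -> exists j : I, (i < j)%O /\ (j < b)%O.

(* B occupies A. *)
Definition occupies (T : Type) (B A : I -> set T) : Prop :=
  (forall i, A i `<=` B i) /\
  (forall b, limit_index b -> A b `<=` \bigcup_(i in [set i | (i < b)%O]) B i).

End Nets.

Definition strongly_baire (X : topologicalType) : Prop :=
  forall (d : Order.disp_t) (I : orderType d),
    well_order (<=%O : rel I) ->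
  forall A B : I -> set X,
    (forall i, closed (A i)) -> increasing_net A ->
    (forall i, closed (B i)) -> increasing_net B ->
    occupies B A ->
    interior (\bigcup_i A i) `<=` closure (\bigcup_i interior (B i)).

(* Main.v *)
Require Import Defs.
From mathcomp Require Import all_boot all_order.
From mathcomp Require Import boolp cardinality wochoice.
From mathcomp Require Import classical_sets topology.

(** Suppose that the closed nets [A], [B] violate the conclusion on a nonempty
    open set [W]: then [W] is covered by the [A i], while every [B i] has empty
    interior in [W]. A finite set [P] meets [W] inside some [A (xi P)], and
    player beta answers the move [(V, P)] by [V] minus [B (xi P)]. A point of
    all the [V n] then avoids every [B (xi (P n))]. Yet if it were in the closure
    of the union of the [P n], it would be in the closure of the union of the
    [A (xi (P n))], which lies in the union of the [B (xi (P n))]: this is where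
    occupation at the supremum of the [xi (P n)] is used. *)

Import Order.TTheory.
Local Open Scope classical_set_scope.

Lemma well_order_least (d : Order.disp_t) (I : orderType d) (S : set I) :
  well_order (<=%O : rel I) -> S !=set0 ->
  exists2 m, S m & forall j, S j -> (m <= j)%O.
Proof.
move=> wo [i Si].
have [|m [[/asboolP Sm lbm] _]] := wo [pred j | `[< S j >]].
  by exists i; apply/asboolP.
by exists m => // j Sj; apply: lbm; apply/asboolP.
Qed.

Lemma finite_subset_increasing (d : Order.disp_t) (I : orderType d) (T : Type)
    (A : I -> set T) (i0 : I) (P : set T) :
  increasing_net A -> finite_set P -> P `<=` \bigcup_i A i ->
  exists i, P `<=` A i.
Proof.
move=> Ainc Pfin PA.
have /choice [f fP] : forall x, exists i, P x -> A i x.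
  move=> x; have [/PA [i _ Aix]|nPx] := pselect (P x); first by exists i.
  by exists i0.
have : finite_set (f @` P) by exact: finite_image.
move=> /finite_seqP [s fPs].
exists (\big[Order.max/i0]_(i <- s) i) => x Px.
apply: Ainc (fP x Px); apply: le_bigmax_seq => //.
have : (f @` P) (f x) by exists x.
by rewrite fPs.
Qed.

(** If the [xi n] are unbounded, one of them is at least an index [i] with [x] in [A i]. Otherwise
    let [b] be their supremum: the closed set [A b] contains every [A (xi n)], hence [x]. Either [b]
    is attained, or it is a limit index in which the [xi n] are cofinal, and occupation at [b]
    applies. *)
Lemma occupies_closure (X : topologicalType) (d : Order.disp_t)
    (I : orderType d) (A B : I -> set X) (xi : nat -> I) :
  well_order (<=%O : rel I) ->
  (forall i, closed (A i)) -> increasing_net A -> increasing_net B ->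
  occupies B A ->
  \bigcup_i A i `&` closure (\bigcup_n A (xi n)) `<=` \bigcup_n B (xi n).
Proof.
move=> wo Acl Ainc Binc [AB Blim] x [[i _ Aix] clx].
have [[b0 ub0]|nub] := pselect (exists b, forall n, (xi n <= b)%O); last first.
  have [n lein] : exists n, (i <= xi n)%O.
    apply: contrapT => nn; apply: nub; exists i => n.
    by rewrite leNgt; apply/negP => /ltW ltin; apply: nn; exists n.
  by exists n => //; apply: AB; apply: Ainc Aix.
have [b ub bmin] : exists2 b, (forall n, (xi n <= b)%O) &
    forall j, (forall n, (xi n <= j)%O) -> (b <= j)%O.
  by apply: (@well_order_least _ _ [set b | forall n, xi n <= b]%O wo); exists b0.
have Abx : A b x.
  apply: Acl; apply: closure_subset clx => y [n _]; exact: Ainc.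
have [[n xin]|nb] := pselect (exists n, xi n = b).
  by exists n => //; apply: AB; rewrite xin.
have ltb n : (xi n < b)%O.
  by rewrite lt_neqAle ub andbT; apply/eqP => e; apply: nb; exists n.
have cof j : (j < b)%O -> exists n, (j < xi n)%O.
  move=> ltjb; apply: contrapT => nn.
  have /bmin : forall n, (xi n <= j)%O.
    by move=> n; rewrite leNgt; apply/negP => ltjn; apply: nn; exists n.
  by rewrite leNgt ltjb.
have [|j ltjb Bjx] := Blim b _ x Abx.
  split; first by exists (xi 0%N).
  by move=> j /cof [n ltjn]; exists (xi n).
have [n /ltW lejn] := cof j ltjb.
by exists n => //; apply: Binc Bjx.
Qed.

Section WinningStrategy.
Variables (X : topologicalType) (PP : set (set X)) (I : Type).
Variables (B : I -> set X) (W : set X) (xi : set X -> I).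

Let default : alpha_move X := (setT, set0).

(** Intersecting with [W] confines the opening move, where [default] stands for alpha's last move;
    the rest of the play then stays in [W]. *)
Definition avoiding_strategy : beta_strategy X :=
  fun h => (W `&` (last default h).1) `\` B (xi (last default h).2).

Lemma avoiding_strategy_legal :
  open W -> W !=set0 -> (forall i, closed (B i)) ->
  (forall i, W `&` interior (B i) = set0) ->
  legal_beta_strategy PP avoiding_strategy.
Proof.
move=> Wo W0 Bcl WB h lh.
suff [Vo V0] : open (last default h).1 /\ W `&` (last default h).1 !=set0.
  rewrite /avoiding_strategy; set i := xi _; split.
  - rewrite setDE; apply: openI; [exact: openI|exact: closed_openC].
  (* If nothing were left, an open nonempty part of [W] would lie in [B i], hence in its interior,
     which misses [W]. *)
  - apply: contrapT => /nonemptyPn; rewrite setD_eq0.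
    rewrite open_subsetE; last exact: openI.
    move=> VB; have [x Vx] := V0.
    suff : (W `&` interior (B i)) x by rewrite WB.
    by split; [case: Vx|exact: VB].
  - by move=> x [[]].
elim/last_ind: h lh => [_|h m _ lh].
  by split; [exact: openT|rewrite setIT].
have := lh (size h); rewrite size_rcons => /(_ (ltnSn _)).
rewrite nth_rcons ltnn eqxx last_rcons -cats1 take_size_cat // => -[mo [x mx] ms _].
by split=> //; exists x; split=> //; have [[]] := ms _ mx.
Qed.

End WinningStrategy.

Theorem theorem2p4 (X : topologicalType) (PP : set (set X)) :
  sigma_system PP -> beta_unfavorable PP -> strongly_baire X.
Proof.
move=> sPP unf d I wo A B Acl Ainc Bcl Binc BA x Ax.
apply: contrapT => clx; apply: unf.
pose W := interior (\bigcup_i A i) `&` ~` closure (\bigcup_i interior (B i)).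
have Wo : open W.
  by apply: openI; [exact: open_interior|exact/closed_openC/closed_closure].
have WA : W `<=` \bigcup_i A i by move=> y [/interior_subset].
have WB i : W `&` interior (B i) = set0.
  by rewrite -subset0 => y [[_ ncl] Biy]; apply/ncl/subset_closure; exists i.
have [i0 _ _] := interior_subset Ax.
(* Alpha may play points outside [W], possibly in no [A i], so only the part of [P] in [W] is
   captured; [i0] is a junk value for infinite [P]. *)
have /choice [xi xiP] : forall P, exists i, finite_set P -> P `&` W `<=` A i.
  move=> P; have [Pfin|] := pselect (finite_set P); last by exists i0.
  have [|y [_ /WA]//|i PA] :=
    @finite_subset_increasing _ _ _ A i0 (P `&` W) Ainc.
    exact: finite_setIl.
  by exists i.
exists (avoiding_strategy X I B W xi); split.
  by apply: avoiding_strategy_legal => //; exists x.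
move=> m lm [y [my cly]].
have Pfin n : finite_set (m n).2.
  have [_ _ _] := lm n.
  by case: sPP => -> //= -[z ->]; exact: finite_set1.
have Wy : W y.
  by have [_ _ /(_ y (my 0%N Logic.I)) [[]]] := lm 0%N.
(* The index shifts by one: the open set of move [n.+1] lies in beta's answer to move [n]. *)
have nBy n : ~ B (xi (m n).2) y.
  have [_ _ /(_ y (my n.+1 Logic.I))] := lm n.+1.
  by rewrite /avoiding_strategy mkseqS last_rcons => -[].
have [|n _ /nBy//] :=
  @occupies_closure _ _ _ A B (fun n => xi (m n).2) wo Acl Ainc Binc BA y.
split; first exact: WA.
(* As [W] is a neighbourhood of [y], the played points close to [y] can be taken in [W], where [xiP]
   applies. *)
move=> N yN.
have /cly [z [[n _ Pz] [Nz Wz]]] : nbhs y (N `&` W).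
  by apply: filterI => //; exact: open_nbhs_nbhs.
by exists z; split=> //; exists n => //; apply: xiP.
Qed.
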